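(* Let $X$ be a compact Hausdorff space, $\alpha\colon X\to X$ continuous, $\delta f=f\circ\alpha$ on $C(X)$, and $A\colon C(X)\to C(X)$ a transfer operator for $(X,\alpha)$. Then for every $\mu\in M(X)$ and every $\varepsilon>0$ there exist a neighborhood $O(\mu)$ of $\mu$ in the weak$^*$ topology, a number $C(\varepsilon,\mu)$, and a sequence of functions $\chi_n\in C(X)$ with $\chi_n\ge$ the indicator function of $X_n(O(\mu))$ for all $n$, such that for all $n\in\mathbb N$ \[ \|A^n\chi_n\|\le C(\varepsilon,\mu)\,e^{n(\tau(\mu)+\varepsilon)}, \] where, if $\tau(\mu)=-\infty$, the number $\tau(\mu)+\varepsilon$ is replaced by $-1/\varepsilon$.
   Context: $C(X)$ is the space of real continuous functions with the supremum norm; $\mathbf 1$ is the constant function $1$. A transfer operator for $(X,\alpha)$ is a positive linear operator $A\colon C(X)\to C(X)$ with $A((f\circ\alpha)g)=f\,Ag$ for all $f,g\in C(X)$. $M(X)$ is the set of Borel probability measures on $X$ (regular, identified with positive normalized functionals on $C(X)$), with the weak$^*$ topology; $M_\delta$ denotes the $\alpha$-invariant ones ($\mu[f\circ\alpha]=\mu[f]$ for all $f$). For $x\in X$ the empirical measure is $\delta_{x,n}(f)=\frac1n\sum_{i=0}^{n-1}f(\alpha^i(x))$, and $X_n(O(\mu))=\{x\in X:\delta_{x,n}\in O(\mu)\}$. The $t$-entropy: a partition of unity is a finite set $D$ of nonnegative functions in $C(X)$ summing to $\mathbf 1$; for $\mu\in M_\delta$, $\tau_n(\mu,D)=\sup_{m\in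 M(X)}\sum_{g\in D}\mu[g]\ln\frac{m[A^ng]}{\mu[g]}$ (summands with $\mu[g]=0$ are $0$, $\ln0=-\infty$), $\tau(\mu)=\inf_{n\in\mathbb N}\frac1n\inf_D\tau_n(\mu,D)$, with $\tau(\mu)=-\infty$ if some $g\in D$ has $A^ng=0$ and $\mu[g]>0$; for $\mu\in M(X)\setminus M_\delta$ one sets $\tau(\mu)=-\infty$. *)

(* Defs.v *)
From HB Require Import structures.
From mathcomp Require Import all_boot all_order all_algebra.
From mathcomp Require Import all_classical all_reals all_analysis.
From Stdlib Require List.

Set Implicit Arguments.
Unset Strict Implicit.
Unset Printing Implicit Defensive.

Import Order.TTheory GRing.Theory Num.Theory.
Import numFieldNormedType.Exports.
Local Open Scope classical_set_scope.
Local Open Scope ring_scope.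

Section Defs.
Variables (R : realType) (X : topologicalType).

Definition contf (f : X -> R) : Prop := continuous f.

(* A positive linear operator A : C(X) -> C(X) with
   A((f o alpha) g) = f (A g) for all f g in C(X).  A is encoded as a map on
   all functions X -> R; only its behaviour on C(X) is constrained/used. *)
Definition transfer_operator (alpha : X -> X) (A : (X -> R) -> (X -> R)) : Prop :=
  [/\ (forall f, contf f -> contf (A f)),
      (forall f g, contf f -> contf g -> A (f \+ g) = A f \+ A g),
      (forall (c : R) f, contf f -> A (fun x => c * f x) = (fun x => c * A f x)),
      (forall f, contf f -> (forall x, 0 <= f x) -> forall x, 0 <= A f x) &
      (forall f g, contf f -> contf g ->
         A (fun x => f (alpha x) * g x) = (fun x => f x * A g x))].

(* M(X): Borel probability measures, identified (Riesz) with positive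
   normalized linear functionals on C(X). *)
Definition prob_functional (m : (X -> R) -> R) : Prop :=
  [/\ (forall f g, contf f -> contf g -> m (f \+ g) = m f + m g),
      (forall (c : R) f, contf f -> m (fun x => c * f x) = c * m f),
      (forall f, contf f -> (forall x, 0 <= f x) -> 0 <= m f) &
      m (fun _ => 1) = 1].

Definition invariant (alpha : X -> X) (mu : (X -> R) -> R) : Prop :=
  forall f, contf f -> mu (f \o alpha) = mu f.

Definition empirical (alpha : X -> X) (n : nat) (x : X) : (X -> R) -> R :=
  fun f => n%:R^-1 * \sum_(i < n) f (iter i alpha x).

Definition Xn (alpha : X -> X) (n : nat) (O : ((X -> R) -> R) -> Prop) : set X :=
  [set x | O (empirical alpha n x)].

(* O is a neighbourhood of mu in the weak* topology of M(X): it contains a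
   basic weak* open set {nu in M(X) : |nu f_i - mu f_i| < e, i = 1..k}. *)
Definition weak_nbhs (mu : (X -> R) -> R) (O : ((X -> R) -> R) -> Prop) : Prop :=
  exists (fs : seq (X -> R)) (e : R),
    [/\ 0 < e, (forall f, List.In f fs -> contf f) &
        forall nu, prob_functional nu ->
          (forall f, List.In f fs -> `|nu f - mu f| < e) -> O nu].

(* Finite partitions of unity (finite sets of functions: no duplicates). *)
Definition partition_unity (D : seq (X -> R)) : Prop :=
  [/\ List.NoDup D, (forall g, List.In g D -> contf g /\ forall x, 0 <= g x) &
      forall x, \sum_(g <- D) g x = 1].

(* Summand mu[g] ln (m[A^n g] / mu[g]), with the convention 0 if mu[g] = 0
   and ln 0 = -oo. *)
Definition tau_term (A : (X -> R) -> (X -> R)) (n : nat)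
    (mu m : (X -> R) -> R) (g : X -> R) : \bar R :=
  if mu g == 0 then 0%E
  else if 0 < m (iter n A g) then (mu g * ln (m (iter n A g) / mu g))%:E
  else -oo%E.

Definition tau_n (A : (X -> R) -> (X -> R)) (n : nat)
    (mu : (X -> R) -> R) (D : seq (X -> R)) : \bar R :=
  ereal_sup [set (\sum_(g <- D) tau_term A n mu m g)%E | m in prob_functional].

Definition t_entropy (alpha : X -> X) (A : (X -> R) -> (X -> R))
    (mu : (X -> R) -> R) : \bar R :=
  if `[< invariant alpha mu >] then
    ereal_inf [set ((n%:R)^-1%:E * ereal_inf [set tau_n A n mu D | D in partition_unity])%E
              | n in [set n : nat | (0 < n)%N]]
  else -oo%E.

End Defs.

(* Exponent tau(mu) + eps, replaced by -1/eps when tau(mu) = -oo.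
   (tau(mu) = +oo never happens since tau_n(mu,{1}) <= ln ||A^n 1||.) *)
Definition tau_exponent (R : realType) (t : \bar R) (eps : R) : R :=
  match t with
  | EFin r => r + eps
  | _ => - eps^-1
  end.

(* Main.v *)
(* If mu is not invariant, some f has mu(f o alpha) <> mu(f), whereas the
   empirical averages of f o alpha and f differ by O(1/n); hence X_n(O) is empty
   for large n and chi_n = 0 works.
   If mu is invariant, choose n = N and a partition D with tau_N(mu, D) < N c,
   where c is the target exponent.  The first-order condition at a (near)
   maximizer of m |-> sum_g mu[g] ln (m[A^N g] / mu[g]) yields weights u_g > 0
   with sum_g u_g A^N g <= 1 and sum_g mu[g] ln u_g > - N c.  By convexity of
   exp, phi = sum_g (ln u_g) g satisfies A^N e^phi <= 1 and mu[phi] > - N c.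
   Iterating along each residue class mod N and averaging the N classes (convexity
   again) bounds A^n exp (S_n phi / N) uniformly in n, where S_n is the Birkhoff
   sum; as S_n phi is about n mu[phi] on X_n(O), a rescaling of exp (S_n phi / N)
   serves as chi_n. *)
Require Import Defs.
From HB Require Import structures.
From mathcomp Require Import all_boot all_order all_algebra.
From mathcomp Require Import all_classical all_reals all_analysis.
From mathcomp Require Import ring lra.
From Stdlib Require List.
Import Order.TTheory GRing.Theory Num.Theory.
Import numFieldNormedType.Exports.
Local Open Scope classical_set_scope.
Local Open Scope ring_scope.

(** * Duality for the logarithmic functional *)

Lemma ln_ge_1BV (R : realType) (z : R) : 0 < z -> 1 - z^-1 <= ln z.
Proof.
move=> z0; have zi0 : 0 < z^-1 by rewrite invr_gt0.
have := expR_ge1Dx (ln z^-1); rewrite lnK ?posrE // lnV ?posrE //; lra.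
Qed.

(* Applied with y = w / v to the logarithmic increment from v to (1 - t) v + t w. *)
Lemma le_ln_mix (R : realType) (y t L : R) : 0 <= y -> y <= L -> 0 < t < 1 ->
  y <= (1 + t * L) * (ln (1 - t + t * y) / t + (1 - t)^-1).
Proof.
move=> y0 yL /andP[t0 t1].
set z := 1 - t + t * y.
have zt : 1 - t <= z by rewrite lerDl mulr_ge0 // ltW.
have z0 : 0 < z by apply: lt_le_trans zt; rewrite subr_gt0.
have zL : z <= 1 + t * L by rewrite /z; nra.
have iz : z^-1 <= (1 - t)^-1 by rewrite lef_pV2 // posrE subr_gt0.
have h : (y - 1) / z <= ln z / t.
  rewrite ler_pdivlMr //; apply: le_trans (ln_ge_1BV _ _ z0).
  suff -> : (y - 1) / z * t = 1 - z^-1 by [].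
  have -> : y - 1 = (z - 1) / t by rewrite /z; field; rewrite gt_eqF.
  by field; rewrite !gt_eqF.
have h2 : y / z <= ln z / t + (1 - t)^-1.
  by rewrite -[y / z](_ : (y - 1) / z + z^-1 = _) ?lerD //; field; rewrite gt_eqF.
have yz0 : 0 <= y / z by rewrite divr_ge0 // ltW.
rewrite [leLHS](_ : y = z * (y / z)); last by field; rewrite gt_eqF.
by apply: ler_pM => //; rewrite ltW.
Qed.

Lemma near_maximizer (R : realType) (T : Type) (P : T -> Prop) (F : T -> R)
    (s theta : R) : (exists x, P x) -> (forall x, P x -> F x <= s) -> 0 < theta ->
  exists2 x, P x & forall y, P y -> F y <= F x + theta.
Proof.
move=> [x0 Px0] Fs th0.
have hs : has_sup [set F x | x in P].
  split; first by exists (F x0), x0.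
  by exists s => _ [x Px <-]; exact: Fs.
have [_ [x Px <-] hx] := sup_adherent th0 hs.
exists x => // y Py.
have : F y <= sup [set F x | x in P] by apply: ub_le_sup; [exact: hs.2|exists y].
lra.
Qed.

(** Jensen's inequality: with [c] the mean of [y], the tangent line gives exp (y i) >= exp c * (1 +
    y i - c), and the weighted sum of the right-hand sides is exp c. *)
Lemma weighted_expR (R : realType) (I : finType) (w y : I -> R) :
  (forall i, 0 <= w i) -> \sum_i w i = 1 ->
  expR (\sum_i w i * y i) <= \sum_i w i * expR (y i).
Proof.
move=> w0 w1; set c := \sum_i w i * y i.
have -> : expR c = \sum_i w i * (expR c * (1 + (y i - c))).
  have -> : \sum_i w i * (expR c * (1 + (y i - c))) =
      \sum_i (w i * (expR c * (1 - c)) + expR c * (w i * y i)).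
    by apply: eq_bigr => i _; ring.
  by rewrite big_split /= -mulr_suml w1 -mulr_sumr -/c; ring.
apply: ler_sum => i _; apply: ler_wpM2l => //.
rewrite -[in leRHS](subrK c (y i)) expRD mulrC ler_wpM2r ?expR_ge0 //.
exact: expR_ge1Dx.
Qed.

(** Witnesses are added one index at a time by taking midpoints: as all coordinates are nonnegative,
    a midpoint keeps every positive coordinate of either end. *)
Lemma convex_support (R : realFieldType) (I : eqType) (V : (I -> R) -> Prop) (J : seq I) :
  (exists v, V v) ->
  (forall v, V v -> forall i, 0 <= v i) ->
  (forall v w t, V v -> V w -> 0 <= t <= 1 -> V (fun i => (1 - t) * v i + t * w i)) ->
  (forall i, i \in J -> exists2 v, V v & 0 < v i) ->
  exists2 v, V v & forall i, i \in J -> 0 < v i.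
Proof.
move=> [v0 Vv0] V0 Vc; elim: J => [|j J IH] hJ; first by exists v0.
have [i iJ|v Vv vJ] := IH; first by apply: hJ; rewrite inE iJ orbT.
have [w Vw wj] := hJ j (mem_head _ _).
exists (fun i => (1 - 2^-1) * v i + 2^-1 * w i).
  by apply: Vc => //; apply/andP; split; lra.
move=> i; have := V0 _ Vv i; have := V0 _ Vw i.
rewrite inE => ? ? /orP[/eqP ij|/vJ]; last lra.
by subst i; lra.
Qed.

(** The left side is, up to a constant, the derivative at [v] towards [w] of the log functional. A
    finite step [t] stands in for the derivative, and [le_ln_mix] is summed with y = w i / v i. *)
Lemma first_order_bound (R : realType) (I : finType) (p v w : I -> R) (t L theta : R) :
  (forall i, 0 <= p i) -> \sum_i p i = 1 ->
  (forall i, 0 < p i -> 0 < v i) -> (forall i, 0 <= w i) ->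
  (forall i, 0 < p i -> w i / v i <= L) -> 0 <= L -> 0 < t < 1 ->
  \sum_i p i * ln (((1 - t) * v i + t * w i) / p i) <=
    \sum_i p i * ln (v i / p i) + theta ->
  \sum_i p i / v i * w i <= (1 + t * L) * (theta / t + (1 - t)^-1).
Proof.
move=> p0 p1 v0 w0 wL L0 /andP[t0 t1] hth.
pose F i := p i * ln (((1 - t) * v i + t * w i) / p i) - p i * ln (v i / p i).
have hF : \sum_i F i <= theta by rewrite /F sumrB lerBlDl.
have tL : 0 <= 1 + t * L by rewrite addr_ge0 // mulr_ge0 // ltW.
apply: (@le_trans _ _ ((1 + t * L) * (\sum_i (F i / t + p i * (1 - t)^-1)))); last first.
  by rewrite big_split /= -!mulr_suml p1 mul1r ler_wpM2l // lerD2r ler_wpM2r // invr_ge0 ltW.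
rewrite mulr_sumr; apply: ler_sum => i _.
have [pi0|] := ltP 0 (p i); last first.
  move=> pi_le0; have -> : p i = 0 by apply: le_anti; rewrite pi_le0 p0.
  have -> : F i = 0 by rewrite /F (_ : p i = 0) ?mul0r ?subrr //; apply: le_anti; rewrite pi_le0 p0.
  by rewrite !mul0r addr0 mulr0.
have vi0 := v0 _ pi0.
have z0 : 0 < 1 - t + t * (w i / v i).
  by rewrite ltr_pwDl ?subr_gt0 // mulr_ge0 ?divr_ge0 // ltW.
have -> : F i = p i * ln (1 - t + t * (w i / v i)).
  rewrite /F -mulrBr -ln_div ?posrE ?divr_gt0 //; last first.
    by rewrite ltr_pwDl ?mulr_gt0 ?subr_gt0 // mulr_ge0 // ltW.
  by congr (_ * ln _); field; rewrite !gt_eqF.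
have h := le_ln_mix _ (w i / v i) t L.
rewrite (_ : p i / v i * w i = p i * (w i / v i)); last by ring.
rewrite (_ : (1 + t * L) * _ =
   p i * ((1 + t * L) * (ln (1 - t + t * (w i / v i)) / t + (1 - t)^-1))); last by ring.
apply: ler_wpM2l => //; apply: h; last by rewrite t0.
  by rewrite divr_ge0 // ltW.
exact: wL.
Qed.

(** This is the factor from [first_order_bound] for step z ^ 2, error z ^ 4 and ratio bound L / z,
    with a further loss of 1 / (1 - z). The three factors are at most exp (z L), exp (3 z) and exp
    (2 z), whence the 5. *)
Lemma first_order_constant (R : realType) (z L : R) : 0 < z -> z <= 2^-1 -> 0 <= L ->
  (1 + z * L) * (z ^+ 2 + (1 - z ^+ 2)^-1) / (1 - z) <= expR (z * (L + 5)).
Proof.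
move=> z0 z1 L0.
have zz : z ^+ 2 <= z by rewrite expr2; nra.
have i1 (y : R) : 0 < y -> y <= 2^-1 -> (1 - y)^-1 <= 1 + 2 * y.
  move=> y0 y1; rewrite -[leLHS]mul1r ler_pdivrMr; last lra.
  by nra.
have z20 : 0 < z ^+ 2 by rewrite exprn_gt0.
have h1 : (1 - z)^-1 <= expR (2 * z) by apply: le_trans (expR_ge1Dx _); apply: i1.
have h2 : z ^+ 2 + (1 - z ^+ 2)^-1 <= expR (3 * z).
  apply: le_trans (expR_ge1Dx _).
  have := i1 _ z20; lra.
have h3 := expR_ge1Dx (z * L).
rewrite (_ : z * (L + 5) = z * L + 3 * z + 2 * z); last by ring.
rewrite !expRD; apply: ler_pM => //.
- apply: mulr_ge0; first by rewrite addr_ge0 // mulr_ge0 // ltW.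
  by rewrite addr_ge0 ?invr_ge0 //; lra.
- by rewrite invr_ge0; lra.
apply: ler_pM => //; first by rewrite addr_ge0 // mulr_ge0 // ltW.
by rewrite addr_ge0 ?invr_ge0 //; lra.
Qed.

Section Duality.
Variables (R : realType) (I : finType) (V : (I -> R) -> Prop) (p : I -> R) (M s eta : R).
Hypotheses (eta0 : 0 < eta) (p0 : forall i, 0 <= p i) (p1 : \sum_i p i = 1)
  (V_inhab : exists v, V v) (V_bound : forall v, V v -> forall i, 0 <= v i <= M)
  (V_convex : forall v w t, V v -> V w -> 0 <= t <= 1 ->
     V (fun i => (1 - t) * v i + t * w i)).

Let M0 (i : I) : 0 <= M.
Proof. by have [v /V_bound /(_ i) /andP[]] := V_inhab; apply: le_trans. Qed.

(** The weight at [i0] does not enter the constraint, so it can be raised until the sum of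
    logarithms equals - s. *)
Lemma duality_degenerate i0 : 0 < p i0 -> (forall v, V v -> v i0 = 0) ->
  exists u : I -> R, [/\ forall i, 0 < u i, forall v, V v -> \sum_i u i * v i <= 1 &
    - s <= \sum_i p i * ln (u i)].
Proof.
move=> pi0 Vi0.
have M0' := M0 i0.
(* Small enough that the weights [c] contribute at most #|I| * c * M <= 1; [b] below then solves for
   the logarithm of the weight at [i0]. *)
pose c := (1 + #|I|%:R * M)^-1.
have d0 : 0 < 1 + #|I|%:R * M by rewrite ltr_pwDl // mulr_ge0.
have c0 : 0 < c by rewrite invr_gt0.
pose b := (- s - \sum_(i | i != i0) p i * ln c) / p i0.
exists (fun i => if i == i0 then expR b else c); split.
- by move=> i; case: ifP => _ //; apply: expR_gt0.
- move=> v Vv; apply: (@le_trans _ _ (\sum_(i : I) c * M)).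
    apply: ler_sum => i _; case: eqP => [->|_].
      by rewrite Vi0 // mulr0 mulr_ge0 // ltW.
    by rewrite ler_wpM2l ?(ltW c0) //; have /andP[] := V_bound _ Vv i.
  rewrite sumr_const -mulr_natl /c mulrCA mulrC ler_pdivrMr //; lra.
- rewrite (bigD1 i0) //= eqxx expRK.
  rewrite (eq_bigr (fun i => p i * ln c)); last by move=> i /negbTE ->.
  by rewrite /b mulrC divfK ?subrK // gt_eqF.
Qed.

Hypothesis V_entropy : forall v, V v -> (forall i, 0 < p i -> 0 < v i) ->
  \sum_i p i * ln (v i / p i) <= s.

(* A near maximizer [w0] is taken in [W], the values (1 - z) v + z v1, on which
   the logarithms stay bounded below; this replaces a compactness argument.  The
   step z ^ 2 and the error z ^ 4 make the first-order condition exact up to a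
   factor exp (O(z)). *)
Lemma duality_nondegenerate v1 : V v1 -> (forall i, 0 < p i -> 0 < v1 i) ->
  exists u : I -> R, [/\ forall i, 0 < u i, forall v, V v -> \sum_i u i * v i <= 1 &
    - s - eta <= \sum_i p i * ln (u i)].
Proof.
move=> Vv1 v1p.
have [i1 pi1] : exists i, 0 < p i.
  apply: contrapT => h; have : \sum_i p i <= 0.
    by apply: sumr_le0 => i _; rewrite leNgt; apply/negP => hi; apply: h; exists i.
  by rewrite p1 ler10.
have M0' := M0 i1.
(* A single bound for all ratios M / v1 i with 0 < p i. Where [v1 i] is 0 the quotient is 0 by
   convention, so all terms are nonnegative. *)
pose L := \sum_i M / v1 i.
have L0 : 0 <= L.
  by apply: sumr_ge0 => i _; rewrite divr_ge0 //; have /andP[] := V_bound _ Vv1 i.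
pose z := Num.min 2^-1 (eta / 2 / (L + 5)).
have L5 : 0 < L + 5 by lra.
have z0 : 0 < z by rewrite lt_min invr_gt0 ltr0n /= !divr_gt0.
have z12 : z <= 2^-1 by rewrite ge_min lexx.
have zL : z * (L + 5) <= eta / 2 by rewrite -ler_pdivlMr // ge_min lexx orbT.
have zz0 : 0 < z ^+ 2 by rewrite exprn_gt0.
have zz1 : z ^+ 2 < 1 by rewrite expr2; nra.
pose W w := exists2 v, V v & w = (fun i => (1 - z) * v i + z * v1 i).
have WV w : W w -> V w.
  by move=> [v Vv ->]; apply: V_convex => //; apply/andP; split; lra.
have Wp w : W w -> forall i, z * v1 i <= w i.
  move=> [v Vv ->] i; rewrite lerDr mulr_ge0 //; first by lra.
  by have /andP[] := V_bound _ Vv i.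
have Wp' w i : W w -> 0 < p i -> 0 < w i.
  by move=> Ww pi0; apply: lt_le_trans (Wp _ Ww i); rewrite mulr_gt0 // v1p.
have W_inh : exists w, W w by exists (fun i => (1 - z) * v1 i + z * v1 i), v1.
have [w0 Ww0 hw0] := near_maximizer _ _ W (fun w => \sum_i p i * ln (w i / p i)) s
  _ W_inh (fun w Ww => V_entropy _ (WV _ Ww) (fun i => Wp' _ i Ww))
  (exprn_gt0 4 z0).
have key v : V v -> \sum_i p i / w0 i * v i <= expR (eta / 2).
  move=> Vv; pose w i := (1 - z) * v i + z * v1 i.
  have Ww : W w by exists v.
  have h := first_order_bound _ _ p w0 w (z ^+ 2) (L / z) (z ^+ 4) p0 p1.
  have {}h : \sum_i p i / w0 i * w i <=
      (1 + z ^+ 2 * (L / z)) * (z ^+ 4 / z ^+ 2 + (1 - z ^+ 2)^-1).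
    apply: h.
    - by move=> i; apply: Wp'.
    - by move=> i; have /andP[] := V_bound _ (WV _ Ww) i.
    - move=> i pi0; have /andP[_ wM] := V_bound _ (WV _ Ww) i.
      have vp := v1p _ pi0.
      have ML : M / v1 i <= L.
        rewrite /L (bigD1 i) //= lerDl; apply: sumr_ge0 => j _.
        by rewrite divr_ge0 //; have /andP[] := V_bound _ Vv1 j.
      apply: (@le_trans _ _ (M / (z * v1 i))).
        apply: ler_pM => //; first by have /andP[] := V_bound _ (WV _ Ww) i.
          by rewrite invr_ge0 ltW // (Wp' w0).
        by rewrite lef_pV2 ?posrE ?(Wp' w0 i) ?(Wp w0 Ww0) ?mulr_gt0.
      by rewrite invfM mulrCA mulrC ler_pM2r // invr_gt0.
    - by rewrite divr_ge0 // ltW.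
    - by rewrite zz0.
    - apply: hw0; case: Ww0 => v0 Vv0 ->.
      (* The two points of [W] share the component z * v1, so mixing them only mixes [v0] and
         [v]. *)
      exists (fun i => (1 - z ^+ 2) * v0 i + z ^+ 2 * v i).
        by apply: V_convex => //; rewrite !ltW.
      by apply/funext => i; rewrite /w; ring.
  have hz : (1 + z ^+ 2 * (L / z)) * (z ^+ 4 / z ^+ 2 + (1 - z ^+ 2)^-1) =
     (1 + z * L) * (z ^+ 2 + (1 - z ^+ 2)^-1).
    congr (_ * _); first by field; rewrite gt_eqF.
    by congr (_ + _); field; rewrite gt_eqF.
  rewrite hz in h.
  (* Since w >= (1 - z) v, going back from [w] to [v] costs the factor 1 / (1 - z). *)
  have le1 : (1 - z) * \sum_i p i / w0 i * v i <= \sum_i p i / w0 i * w i.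
    rewrite mulr_sumr; apply: ler_sum => i _; rewrite mulrCA ler_wpM2l //.
      by rewrite divr_ge0 //; have /andP[] := V_bound _ (WV _ Ww0) i.
    rewrite lerDl mulr_ge0 //; first exact: ltW.
    by have /andP[] := V_bound _ Vv1 i.
  apply: le_trans (_ : expR (z * (L + 5)) <= _); last by rewrite ler_expR.
  apply: le_trans (first_order_constant _ _ _ z0 z12 L0).
  rewrite ler_pdivlMr; last by lra.
  by rewrite mulrC; apply: le_trans le1 h.
pose K := 1 + #|I|%:R * M.
have K0 : 0 < K by rewrite ltr_pwDl // mulr_ge0.
(* Indices with p i = 0 also need a positive weight; [kappa] keeps their total contribution below
   eta / 2. The scaling by exp (- eta) in [u] then suffices, because exp (eta / 2) + eta / 2 <= exp
   eta. *)
pose kappa := eta / 2 / K.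
have ka0 : 0 < kappa by rewrite !divr_gt0.
pose u i := expR (- eta) * (if 0 < p i then p i / w0 i else kappa).
exists u; split.
- move=> i; rewrite mulr_gt0 ?expR_gt0 //; case: ifP => // pi0.
  by rewrite divr_gt0 // (Wp' w0).
- move=> v Vv.
  rewrite /u; under eq_bigr do rewrite -mulrA.
  rewrite -mulr_sumr mulrC expRN ler_pdivrMr ?expR_gt0 // mul1r.
  apply: (@le_trans _ _ (\sum_i (p i / w0 i * v i + kappa * M))).
    apply: ler_sum => i _; have /andP[vi0 viM] := V_bound _ Vv i.
    have /andP[w00 _] := V_bound _ (WV _ Ww0) i.
    case: ifP => _; first by rewrite lerDl mulr_ge0 // ltW.
    apply: le_trans (_ : kappa * M <= _); first by rewrite ler_wpM2l // ltW.
    by rewrite lerDr mulr_ge0 // divr_ge0.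
  rewrite big_split /= sumr_const.
  have h1 := key _ Vv.
  have h2 : kappa * M *+ #|I| <= eta / 2.
    rewrite -mulr_natl (_ : _ * _ = eta / 2 * (#|I|%:R * M / K)); last first.
      by rewrite /kappa; ring.
    rewrite ler_piMr ?divr_ge0 ?(ltW eta0) // ler_pdivrMr // mul1r /K; lra.
  have h4 := expR_ge1Dx (eta / 2).
  have e2 : 0 < eta / 2 by rewrite divr_gt0.
  have h3 : 1 <= expR (eta / 2) by apply: le_trans h4; rewrite lerDl ltW.
  rewrite [X in expR X](_ : eta = eta / 2 + eta / 2); last lra.
  rewrite expRD.
  have : expR (eta / 2) * (1 + eta / 2) <= expR (eta / 2) * expR (eta / 2).
    by rewrite ler_wpM2l // expR_ge0.
  nra.
- have hw := V_entropy _ (WV _ Ww0) (fun i => Wp' _ i Ww0).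
  suff -> : \sum_i p i * ln (u i) = - (\sum_i p i * ln (w0 i / p i)) - eta by lra.
  rewrite -[X in _ - X]mul1r -p1 mulr_suml -sumrN -sumrB.
  apply: eq_bigr => i _; rewrite /u.
  have := p0 i; rewrite le_eqVlt => /predU1P[<-|pi0]; first by ring.
  rewrite pi0 lnM ?posrE ?expR_gt0 ?divr_gt0 ?(Wp' w0 i) // expRK.
  by rewrite -[w0 i / p i]invrK lnV ?posrE ?invr_gt0 ?divr_gt0 ?(Wp' w0 i) // invf_div; ring.
Qed.

(** In the application [V] consists of the vectors m (T (g i)), with m a probability functional, and
    p i = mu (g i). If no coordinate charged by [p] vanishes on all of [V], convexity gives one [v1]
    positive at all of them. *)
Lemma log_sup_duality :
  exists u : I -> R, [/\ forall i, 0 < u i, forall v, V v -> \sum_i u i * v i <= 1 &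
    - s - eta <= \sum_i p i * ln (u i)].
Proof.
have [[i0 [pi0 Vi0]]|hn] := pselect (exists i0, 0 < p i0 /\ forall v, V v -> v i0 = 0).
  have [u [u0 uV us]] := duality_degenerate _ pi0 Vi0.
  by exists u; split => //; apply: le_trans us; rewrite gerBl ltW.
have [|i|v1 Vv1 v1p] := convex_support R I V [seq i <- enum I | 0 < p i] V_inhab _ V_convex.
- by move=> v Vv i; have /andP[] := V_bound _ Vv i.
- rewrite mem_filter => /andP[pi0 _]; apply: contrapT => h; apply: hn.
  exists i; split => // v Vv; apply: le_anti; have /andP[-> _] := V_bound _ Vv i.
  by rewrite andbT leNgt; apply/negP => ?; apply: h; exists v.
by apply: (duality_nondegenerate v1 Vv1) => i pi0; apply: v1p; rewrite mem_filter pi0 mem_enum.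
Qed.

End Duality.

(** * Transfer operators and Birkhoff sums *)

Section ContinuousFunctions.
Variables (R : realType) (X : topologicalType).
Implicit Types f g : X -> R.

Lemma contf_cst (c : R) : contf (fun _ : X => c).
Proof. by move=> x; apply: cvg_cst. Qed.

Lemma contfD f g : contf f -> contf g -> contf (fun x => f x + g x).
Proof. by move=> cf cg x; apply: continuousD; [exact: cf|exact: cg]. Qed.

Lemma contfM f g : contf f -> contf g -> contf (fun x => f x * g x).
Proof. by move=> cf cg x; apply: continuousM; [exact: cf|exact: cg]. Qed.

Lemma contf_expR f : contf f -> contf (fun x => expR (f x)).
Proof. by move=> cf x; apply: continuous_comp; [exact: cf|exact: continuous_expR]. Qed.

Lemma contf_comp f (beta : X -> X) : contf f -> continuous beta -> contf (fun x => f (beta x)).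
Proof. by move=> cf cb x; apply: continuous_comp; [exact: cb|exact: cf]. Qed.

Lemma contf_sum (I : Type) (r : seq I) (F : I -> X -> R) :
  (forall i, contf (F i)) -> contf (fun x => \sum_(i <- r) F i x).
Proof.
move=> cF; elim: r => [|i r IH].
  by under eq_fun do rewrite big_nil; apply: contf_cst.
by under eq_fun do rewrite big_cons; apply: contfD.
Qed.

Lemma contf_bounded f : compact [set: X] -> contf f ->
  exists2 M : R, 0 <= M & forall x, `|f x| <= M.
Proof.
move=> cX cf.
have cK : compact (f @` [set: X]).
  by apply: continuous_compact => //; apply: continuous_subspaceT.
have [M [_ hM]] := compact_bounded cK.
exists (`|M| + 1) => [|x]; first by rewrite addr_ge0.
by apply: (hM (`|M| + 1)); [rewrite (le_lt_trans (ler_norm M)) // ltrDl|exists x].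
Qed.

Lemma iter_continuous (alpha : X -> X) n : continuous alpha -> continuous (iter n alpha).
Proof.
move=> ca; elim: n => [|n IH] x /=; first exact: cvg_id.
by apply: (@continuous_comp _ _ _ (iter n alpha) alpha); [exact: IH|exact: ca].
Qed.

(** Only linearity is asked of [L], so that both [mu] and the evaluations [fun f => T f x]
    qualify. *)
Lemma functional_sum (L : (X -> R) -> R) (I : finType) (u : I -> R) (g : I -> X -> R) :
  (forall f h, contf f -> contf h -> L (f \+ h) = L f + L h) ->
  (forall (c : R) f, contf f -> L (fun x => c * f x) = c * L f) ->
  (forall i, contf (g i)) ->
  L (fun x => \sum_i u i * g i x) = \sum_i u i * L (g i).
Proof.
move=> LD LZ cg; elim: (index_enum I) => [|i r IH].
  under eq_fun do rewrite big_nil.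
  rewrite big_nil -[RHS](mul0r (L (fun _ => 0))) -LZ; last exact: contf_cst.
  by congr L; apply/funext => x; rewrite mul0r.
under eq_fun do rewrite big_cons.
rewrite big_cons -IH -LZ //.
rewrite -LD //; first by apply: contfM => //; apply: contf_cst.
by apply: contf_sum => j; apply: contfM => //; apply: contf_cst.
Qed.

Lemma prob_le (m : (X -> R) -> R) f g : prob_functional m -> contf f -> contf g ->
  (forall x, f x <= g x) -> m f <= m g.
Proof.
move=> [mD mZ m0 _] cf cg fg.
have ch : contf (fun x => g x + -1 * f x).
  by apply: contfD => //; apply: contfM => //; apply: contf_cst.
have -> : g = f \+ (fun x => g x + -1 * f x) by apply/funext => x /=; ring.
by rewrite mD // lerDl m0 // => x; have := fg x; lra.
Qed.

Lemma prob_cst (m : (X -> R) -> R) c : prob_functional m -> m (fun=> c) = c.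
Proof.
move=> [mD mZ m0 m1]; rewrite -[RHS]mulr1 -[in RHS]m1 -mZ; last exact: contf_cst.
by congr m; apply/funext => x; rewrite mulr1.
Qed.

Lemma prob_eval x : prob_functional (fun f : X -> R => f x).
Proof. by split => // f cf; apply. Qed.

Lemma prob_convex (m m' : (X -> R) -> R) t : prob_functional m -> prob_functional m' ->
  0 <= t <= 1 -> prob_functional (fun f => (1 - t) * m f + t * m' f).
Proof.
move=> [mD mZ m0 m1] [mD' mZ' m0' m1'] /andP[t0 t1]; split.
- by move=> f g cf cg; rewrite mD // mD' //; ring.
- by move=> c f cf; rewrite mZ // mZ' //; ring.
- by move=> f cf f0; rewrite addr_ge0 // mulr_ge0 ?m0 ?m0' // subr_ge0.
- by rewrite m1 m1'; ring.
Qed.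

End ContinuousFunctions.

Section TransferOperators.
Variables (R : realType) (X : topologicalType).
Implicit Types (alpha beta : X -> X) (A T : (X -> R) -> (X -> R)).

Lemma transfer_iter alpha A n : continuous alpha -> transfer_operator alpha A ->
  transfer_operator (iter n alpha) (iter n A).
Proof.
move=> ca [Ac AD AZ A0 Am]; elim: n => [|n [Bc BD BZ B0 Bm]]; first by split.
split => /=.
- by move=> f cf; apply: Ac; apply: Bc.
- by move=> f g cf cg; rewrite BD // AD //; apply: Bc.
- by move=> c f cf; rewrite BZ // AZ //; apply: Bc.
- by move=> f cf f0; apply: A0; [apply: Bc|apply: B0].
- move=> f g cf cg.
  rewrite (Bm (fun x => f (alpha x)) g) //; last exact: contf_comp.
  by apply: Am => //; apply: Bc.
Qed.

Lemma transfer_evalD alpha T x : transfer_operator alpha T ->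
  forall f h, contf f -> contf h -> T (f \+ h) x = T f x + T h x.
Proof. by move=> [_ TD _ _ _] f h cf ch; rewrite TD. Qed.

Lemma transfer_evalZ alpha T x : transfer_operator alpha T ->
  forall c f, contf f -> T (fun y => c * f y) x = c * T f x.
Proof. by move=> [_ _ TZ _ _] c f cf; rewrite TZ. Qed.

Lemma transfer_le alpha T f g : transfer_operator alpha T -> contf f -> contf g ->
  (forall x, f x <= g x) -> forall x, T f x <= T g x.
Proof.
move=> hT cf cg fg x; have [_ _ _ T0 _] := hT.
have ch : contf (fun x => g x + -1 * f x).
  by apply: contfD => //; apply: contfM => //; apply: contf_cst.
have -> : g = f \+ (fun x => g x + -1 * f x) by apply/funext => y /=; ring.
rewrite (transfer_evalD _ _ _ hT) // lerDl; apply: T0 => // y.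
by have := fg y; lra.
Qed.

Lemma transfer_bound alpha T f c : transfer_operator alpha T -> contf f ->
  (forall x, f x <= c) -> forall x, T f x <= c * T (fun=> 1) x.
Proof.
move=> hT cf fc x.
rewrite -(transfer_evalZ _ _ _ hT); last exact: contf_cst.
apply: (transfer_le _ _ _ _ hT) => //.
  by apply: contfM; apply: contf_cst.
by move=> y; rewrite mulr1.
Qed.

Lemma transfer_iter1 alpha A B : continuous alpha -> transfer_operator alpha A ->
  0 <= B -> (forall x, A (fun=> 1) x <= B) -> forall n x, iter n A (fun=> 1) x <= B ^+ n.
Proof.
move=> ca hA B0 AB; elim=> [|n IH] x //.
have hn := transfer_iter _ _ n ca hA; have [nc _ _ _ _] := hn.
rewrite iterS exprSr; apply: le_trans (transfer_bound _ _ _ _ hA _ IH x) _.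
  by apply: nc; apply: contf_cst.
by rewrite ler_wpM2l // exprn_ge0.
Qed.

Definition birkhoff alpha n (f : X -> R) x := \sum_(i < n) f (iter i alpha x).

Lemma contf_birkhoff alpha n f : continuous alpha -> contf f -> contf (birkhoff alpha n f).
Proof.
move=> ca cf; apply: contf_sum => i; apply: contf_comp => //.
exact: iter_continuous.
Qed.

Lemma birkhoffD alpha n k f x :
  birkhoff alpha (n + k) f x = birkhoff alpha n f x + birkhoff alpha k f (iter n alpha x).
Proof.
rewrite /birkhoff big_split_ord /=; congr (_ + _).
by apply: eq_bigr => i _; rewrite addnC iterD.
Qed.

Lemma iter_mul (Y : Type) (h : Y -> Y) k n y : iter k (iter n h) y = iter (k * n) h y.
Proof. by elim: k => // k IH; rewrite iterS IH mulSn iterD. Qed.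

(** The times below k * n are sorted by their residue j modulo n; each class is an orbit segment of
    length k under alpha^n. *)
Lemma birkhoff_classes alpha n k f x : birkhoff alpha (k * n) f x =
  \sum_(j < n) birkhoff (iter n alpha) k f (iter j alpha x).
Proof.
elim: k => [|k IH].
  by rewrite /birkhoff big_ord0 big1 // => j _; rewrite big_ord0.
rewrite mulSn addnC birkhoffD IH -big_split /=; apply: eq_bigr => j _.
rewrite -[k.+1]addn1 birkhoffD; congr (_ + _).
rewrite [RHS]/birkhoff big_ord_recl big_ord0 addr0 /= iter_mul.
by rewrite -!iterD addnC.
Qed.

Lemma birkhoff_bound alpha n f M x : (forall y, `|f y| <= M) ->
  birkhoff alpha n f x <= n%:R * M.
Proof.
move=> fM; apply: (@le_trans _ _ (\sum_(i < n) M)).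
  by apply: ler_sum => i _; apply: le_trans (ler_norm _) _.
by rewrite sumr_const card_ord mulr_natl.
Qed.

(** Since S_(k+1) phi = (S_k phi) o beta + phi, the innermost [T] pulls out exp (S_k phi) and leaves
    T (exp phi) <= 1. *)
Lemma iter_transfer_exp beta T (phi : X -> R) k :
  continuous beta -> transfer_operator beta T -> contf phi ->
  (forall x, T (fun y => expR (phi y)) x <= 1) ->
  forall x, iter k T (fun y => expR (birkhoff beta k phi y)) x <= 1.
Proof.
move=> cb hT cphi h; elim: k => [|k IH] x.
  by rewrite /= /birkhoff big_ord0 expR0.
have cE := contf_expR _ _ _ (contf_birkhoff beta k phi cb cphi).
have [Tc _ _ _ Tm] := hT; have cphi' := contf_expR _ _ _ cphi.
have -> : (fun y => expR (birkhoff beta k.+1 phi y)) =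
    (fun y => expR (birkhoff beta k phi (beta y)) * expR (phi y)).
  apply/funext => y; rewrite -[k.+1]add1n birkhoffD expRD mulrC; congr (_ * expR _).
  by rewrite /birkhoff big_ord_recl big_ord0 addr0.
rewrite iterSr (Tm (fun y => expR (birkhoff beta k phi y))) //.
apply: le_trans (IH x).
apply: (transfer_le _ _ _ _ (transfer_iter _ _ k cb hT)) => //.
  by apply: contfM => //; apply: Tc.
by move=> y; rewrite ler_piMr ?expR_ge0.
Qed.

(** A^n is split as A^(n - j - kN) A^(kN) A^j. The factor A^j absorbs the shift, A^(kN) falls under
    [iter_transfer_exp], and the other n - kN iterations cost a factor [B] each. *)
Lemma transfer_shifted_exp alpha A B N (phi : X -> R) n k j :
  continuous alpha -> transfer_operator alpha A ->
  1 <= B -> (forall x, A (fun=> 1) x <= B) -> contf phi ->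
  (forall x, iter N A (fun y => expR (phi y)) x <= 1) -> (j + k * N <= n)%N ->
  forall x, iter n A (fun y => expR (birkhoff (iter N alpha) k phi (iter j alpha y))) x
    <= B ^+ (n - k * N).
Proof.
move=> ca hA B1 AB cphi hphi jkn x.
have B0 : 0 <= B by apply: le_trans B1.
have hI l := transfer_iter _ _ l ca hA.
have cI l : continuous (iter l alpha) by apply: iter_continuous.
set E := fun y => expR (birkhoff (iter N alpha) k phi y).
have cE : contf E by apply/contf_expR/contf_birkhoff.
have -> : (fun y => expR (birkhoff (iter N alpha) k phi (iter j alpha y))) =
    (fun y => E (iter j alpha y) * 1) by apply/funext => y; rewrite mulr1.
have {1}-> : n = (n - (j + k * N) + (k * N + j))%N by rewrite [(k * N + j)%N]addnC subnK.
have [jc _ _ _ jm] := hI j; have [kc _ _ _ km] := hI (k * N)%N.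
rewrite !iterD (jm E) //; last exact: contf_cst.
have c1 : contf (iter j A (fun=> 1)) by apply/jc/contf_cst.
have h1 y : iter (k * N) A (fun z => E z * iter j A (fun=> 1) z) y <= B ^+ j.
  apply: (@le_trans _ _ (iter (k * N) A (fun z => B ^+ j * E z) y)).
    apply: (transfer_le _ _ _ _ (hI _)).
    - exact: contfM.
    - by apply: contfM => //; apply: contf_cst.
    - move=> z; rewrite mulrC ler_wpM2r ?expR_ge0 //.
      exact: transfer_iter1 ca hA B0 AB j z.
  rewrite (transfer_evalZ _ _ _ (hI _)) // ler_piMr ?exprn_ge0 //.
  by rewrite -iter_mul; apply: iter_transfer_exp.
apply: le_trans (transfer_bound _ _ _ _ (hI _) _ h1 x) _.
  by apply: kc; apply: contfM.
apply: (@le_trans _ _ (B ^+ j * B ^+ (n - (j + k * N)))).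
  by rewrite ler_wpM2l ?exprn_ge0 //; apply: transfer_iter1 ca hA B0 AB _ x.
rewrite -exprD; apply: ler_weXn2l => //.
by rewrite leq_subRL ?(leq_trans (leq_addl _ _) jkn) // addnCA addnA subnKC.
Qed.

Lemma transfer_birkhoff_bound alpha A N (phi : X -> R) : compact [set: X] ->
  continuous alpha -> transfer_operator alpha A -> (0 < N)%N -> contf phi ->
  (forall x, iter N A (fun y => expR (phi y)) x <= 1) ->
  exists C, forall n x, iter n A (fun y => expR (N%:R^-1 * birkhoff alpha n phi y)) x <= C.
Proof.
move=> cX ca hA N0 cphi hphi.
have [M M0 phiM] := contf_bounded _ _ _ cX cphi.
have [Ac _ _ _ _] := hA.
have [B1 B10 hB1] := contf_bounded _ _ _ cX (Ac _ (contf_cst _ _ 1)).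
(* With B >= 1 the powers of [B] grow with the exponent. *)
pose B := B1 + 1.
have B_ge1 : 1 <= B by rewrite lerDr.
have AB x : A (fun=> 1) x <= B.
  by apply: le_trans (ler_norm _) _; apply: le_trans (hB1 x) _; rewrite lerDl.
have B0 : 0 <= B by apply: le_trans B_ge1.
have NR : 0 < N%:R :> R by rewrite ltr0n.
(* At most 2 N times lie outside the k full blocks: after division by N they add at most 2 M to the
   exponent, and as iterations of [A] they cost at most B ^ (2 N). *)
exists (expR (2 * M) * B ^+ (2 * N)) => n x.
have hI l := transfer_iter _ _ l ca hA.
(* One block less than n %/ N leaves room for all the shifts j < N. *)
pose k := (n %/ N)%N.-1.
have nE := divn_eq n N; have nm := ltn_pmod n N0.
have kn : (k * N <= n)%N.
  by apply: leq_trans (leq_divM n N); rewrite leq_mul2r leq_pred orbT.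
have nk : (n - k * N <= 2 * N)%N.
  rewrite leq_subLR -mulnDl {1}nE; apply: (@leq_trans ((n %/ N).+1 * N)%N).
    by rewrite mulSn addnC leq_add2r ltnW.
  by rewrite leq_mul2r /k; case: (n %/ N)%N => [|q] /=; rewrite addn2 ?ltnSn !orbT.
(* For n < N the shift j may exceed n, but then k = 0 and [E j] is constantly 1. *)
have jn (j : 'I_N) : k = 0 \/ (j + k * N <= n)%N.
  rewrite /k; case Eq : (n %/ N)%N => [|q] /=; [by left|right].
  by rewrite {1}nE Eq mulSn; apply: leq_trans (leq_addr _ _); rewrite leq_add2r ltnW.
pose E (j : 'I_N) y := expR (birkhoff (iter N alpha) k phi (iter j alpha y)).
have cE j : contf (E j).
  apply: contf_expR; apply: contf_comp; last exact: iter_continuous.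
  by apply: contf_birkhoff => //; apply: iter_continuous.
have pt y : expR (N%:R^-1 * birkhoff alpha n phi y) <=
    \sum_(j < N) (expR (2 * M) / N%:R) * E j y.
  rewrite -[in leLHS](subnKC kn) birkhoffD birkhoff_classes mulrDr expRD mulrC.
  have -> : \sum_(j < N) (expR (2 * M) / N%:R) * E j y =
      expR (2 * M) * \sum_(j < N) N%:R^-1 * E j y.
    by rewrite mulr_sumr; apply: eq_bigr => j _; rewrite mulrA.
  apply: ler_pM; rewrite ?expR_ge0 //.
    rewrite ler_expR ler_pdivrMl //; apply: le_trans (birkhoff_bound _ _ _ _ _ phiM) _.
    by rewrite mulrA -natrM [(N * 2)%N]mulnC ler_wpM2r // ler_nat.
  rewrite mulr_sumr; apply: (weighted_expR _ _ (fun=> N%:R^-1)).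
    by move=> j; rewrite invr_ge0 ltW.
  by rewrite sumr_const card_ord -[LHS]mulr_natl mulfV ?gt_eqF.
apply: le_trans (transfer_le _ _ _ _ (hI n) _ _ pt x) _.
- apply: contf_expR; apply: contfM; first exact: contf_cst.
  exact: contf_birkhoff.
- by apply: contf_sum => j; apply: contfM => //; apply: contf_cst.
rewrite (functional_sum _ _ (fun f => iter n A f x)) //; first last.
- exact: transfer_evalZ (hI n).
- exact: transfer_evalD (hI n).
apply: (@le_trans _ _ (\sum_(j < N) expR (2 * M) / N%:R * B ^+ (2 * N))); last first.
  by rewrite -mulr_suml sumr_const card_ord -[X in X * _]mulr_natr divfK // gt_eqF.
apply: ler_sum => j _; apply: ler_wpM2l; first by rewrite divr_ge0 ?expR_ge0 // ltW.
have [k0|jkn] := jn j; last first.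
  by apply: le_trans (transfer_shifted_exp _ _ _ _ _ _ _ _ ca hA B_ge1 AB cphi hphi jkn x) _;
     apply: ler_weXn2l.
have -> : E j = fun=> 1.
  by apply/funext => y; rewrite /E k0 /birkhoff big_ord0 expR0.
apply: le_trans (transfer_iter1 _ _ _ ca hA B0 AB n x) _.
by apply: ler_weXn2l => //; move: nk; rewrite k0 mul0n subn0.
Qed.

End TransferOperators.

(** * The t-entropy estimate *)

Lemma In_nth (Y : Type) (d : Y) (D : seq Y) i : (i < size D)%N -> List.In (nth d D i) D.
Proof.
elim: D i => [|y D IH] [|i] //= hi; first by left.
by right; apply: IH.
Qed.

Section Potential.
Variables (R : realType) (X : topologicalType).

(** Duality is applied to the vectors m (T (g i)), bounded since g i <= 1. Point evaluations are
    among the m, so the constraint on [u] holds pointwise; as the g i x are weights, Jensen gives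
    exp phi <= sum_i u i * g i. *)
Lemma potential_of_entropy_bound (alpha : X -> X) (T : (X -> R) -> (X -> R))
    (mu : (X -> R) -> R) (k : nat) (g : 'I_k -> X -> R) (s eta : R) :
  compact [set: X] -> transfer_operator alpha T -> prob_functional mu ->
  (forall i, contf (g i)) -> (forall i x, 0 <= g i x) -> (forall x, \sum_i g i x = 1) ->
  (forall m, prob_functional m -> (forall i, 0 < mu (g i) -> 0 < m (T (g i))) ->
     \sum_i mu (g i) * ln (m (T (g i)) / mu (g i)) <= s) ->
  0 < eta ->
  exists phi : X -> R, [/\ contf phi, forall x, T (fun y => expR (phi y)) x <= 1 &
    - s - eta <= mu phi].
Proof.
move=> cX hT hmu cg g0 g1 hs eta0.
have [muD muZ mu0 mu1] := hmu; have [Tc _ _ T0 _] := hT.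
have cTg i : contf (T (g i)) by apply: Tc.
have cT1 : contf (T (fun=> 1)) by apply/Tc/contf_cst.
have [B B0 hB] := contf_bounded _ _ _ cX cT1.
pose V v := exists2 m, prob_functional m & v = (fun i => m (T (g i))).
have p1 : \sum_i mu (g i) = 1.
  rewrite -[RHS]mu1 -(_ : (fun x => \sum_i 1 * g i x) = fun=> 1); last first.
    by apply/funext => x; rewrite -[RHS](g1 x); apply: eq_bigr => i _; rewrite mul1r.
  by rewrite (functional_sum _ _ mu) //; apply: eq_bigr => i _; rewrite mul1r.
have gle1 i x : g i x <= 1.
  by rewrite -(g1 x) (bigD1 i) //= lerDl; apply: sumr_ge0.
have [||v [m hm ->] i|v w t [m hm ->] [m' hm' ->] t01|v [m hm ->] vpos|u [u0 uV us]] :=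
  log_sup_duality _ _ V (fun i => mu (g i)) B s eta eta0 _ p1.
- by move=> i; apply: mu0.
- by exists (fun i => mu (T (g i))), mu.
- have [_ _ m0 _] := hm; rewrite m0 //; last exact: T0.
  rewrite -(prob_cst _ _ m B hm); apply: (prob_le _ _ m) => //; first exact: contf_cst.
  move=> x; apply: le_trans (_ : T (fun=> 1) x <= B); last exact: le_trans (ler_norm _) (hB x).
  by apply: (transfer_le _ _ alpha) => //; apply: contf_cst.
- by exists (fun f => (1 - t) * m f + t * m' f) => //; apply: prob_convex.
- exact: hs.
exists (fun x => \sum_i ln (u i) * g i x).
have cphi : contf (fun x => \sum_i ln (u i) * g i x).
  by apply: contf_sum => i; apply: contfM => //; apply: contf_cst.
split => //.
- move=> x; apply: (@le_trans _ _ (T (fun y => \sum_i u i * g i y) x)).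
    apply: (transfer_le _ _ alpha) => //; first exact: contf_expR.
      by apply: contf_sum => i; apply: contfM => //; apply: contf_cst.
    move=> y; under eq_bigr do rewrite mulrC.
    apply: le_trans (weighted_expR _ _ (fun i => g i y) (fun i => ln (u i)) _ (g1 y)) _ => //.
    by apply: ler_sum => i _; rewrite lnK ?posrE // mulrC.
  rewrite (functional_sum _ _ (fun f => T f x)) //; first last.
  - exact: transfer_evalZ hT.
  - exact: transfer_evalD hT.
  by apply: uV; exists (fun f => f x) => //; apply: prob_eval.
- rewrite (functional_sum _ _ mu) //; apply: le_trans us _.
  by apply: ler_sum => i _; rewrite mulrC.
Qed.

(** Positivity of [m] where [mu] is positive excludes the summands -oo; where [mu] vanishes both
    sums have the term 0. *)
Lemma tau_n_le_sum (A : (X -> R) -> (X -> R)) n (mu m : (X -> R) -> R) (D : seq (X -> R)) (s : R) :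
  (tau_n A n mu D <= s%:E)%E -> prob_functional m ->
  (forall i : 'I_(size D), 0 <= mu (nth (fun=> 0) D i)) ->
  (forall i : 'I_(size D), 0 < mu (nth (fun=> 0) D i) ->
     0 < m (iter n A (nth (fun=> 0) D i))) ->
  \sum_(i < size D) mu (nth (fun=> 0) D i) *
     ln (m (iter n A (nth (fun=> 0) D i)) / mu (nth (fun=> 0) D i)) <= s.
Proof.
move=> hs hm mu0 mpos; rewrite -lee_fin; apply: le_trans hs.
rewrite -sumEFin; apply: ereal_sup_ubound; exists m => //.
rewrite (big_nth (fun=> 0)) big_mkord; apply: eq_bigr => i _; rewrite /tau_term.
have := mu0 i; rewrite le_eqVlt => /predU1P[<-|mui]; first by rewrite eqxx mul0r.
by rewrite gt_eqF // mpos.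
Qed.

(** The value +oo is excluded by n = 1 and the partition {1}, for which ln (m (A 1)) <= m (A 1) <=
    B. Below any real number, -oo needs no further argument. *)
Lemma t_entropy_lt_tau_exponent (alpha : X -> X) (A : (X -> R) -> (X -> R))
    (mu : (X -> R) -> R) (eps : R) :
  compact [set: X] -> transfer_operator alpha A -> prob_functional mu -> 0 < eps ->
  (t_entropy alpha A mu < (tau_exponent (t_entropy alpha A mu) eps)%:E)%E.
Proof.
move=> cX hA hmu eps0.
have [Ac _ _ _ _] := hA.
have [B B0 hB] := contf_bounded _ _ _ cX (Ac _ (contf_cst _ _ 1)).
have hB' : (t_entropy alpha A mu <= B%:E)%E.
  rewrite /t_entropy; case: ifP => _; last exact: leNye.
  have cst1 : contf (fun _ : X => 1 : R) by apply: contf_cst.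
  have [_ _ _ mu1] := hmu.
  apply: ge_ereal_inf; exists ((1%:R)^-1%:E * ereal_inf [set tau_n A 1 mu D | D in @partition_unity R X])%E.
    by exists 1%N.
  rewrite invr1 mul1e; apply: ge_ereal_inf; exists (tau_n A 1 mu [:: fun=> 1]).
    exists [:: fun=> 1] => //; split.
    - by constructor; [case|constructor].
    - by move=> g [<-|[]]; split => // x; rewrite ler01.
    - by move=> x; rewrite big_seq1.
  apply: ge_ereal_sup => _ [m hm <-]; rewrite big_seq1 /tau_term mu1 oner_eq0.
  case: ifP => m0; last exact: leNye.
  rewrite lee_fin mul1r divr1 (le_trans (ltW (ln_sublinear m0))) //.
  rewrite -(prob_cst _ _ m B hm); apply: (prob_le _ _ m) => //; first exact: Ac.
    exact: contf_cst.
  by move=> x; apply: le_trans (ler_norm _) (hB x).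
move: hB'; case: (t_entropy _ _ _) => [r|//|] _; last by rewrite ltNyr.
by rewrite lte_fin /= ltrDl.
Qed.

Lemma t_entropy_lt_witness (alpha : X -> X) (A : (X -> R) -> (X -> R))
    (mu : (X -> R) -> R) (c : R) :
  Defs.invariant alpha mu -> (t_entropy alpha A mu < c%:E)%E ->
  exists n D s, [/\ (0 < n)%N, partition_unity D, (tau_n A n mu D <= s%:E)%E &
    s < n%:R * c].
Proof.
move=> hinv; rewrite /t_entropy asboolT // => /ereal_inf_lt[_ [n /= n0 <-]].
rewrite lte_pdivrMl ?ltr0n // -EFinM => /ereal_inf_lt[_ [D hD <-]] hlt.
case Et : (tau_n A n mu D) hlt => [r| |] hlt //.
- by exists n, D, r; split => //; rewrite ?Et // -lte_fin.
(* When [tau_n] is -oo any real bound is valid; this one lies below n * c. *)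
- exists n, D, (n%:R * c - 1); split => //; first by rewrite Et leNye.
  by rewrite ltrBlDr ltrDl.
Qed.

End Potential.

(** * Exponential bounds over weak-star neighbourhoods *)

Section NeighbourhoodBounds.
Variables (R : realType) (X : topologicalType) (alpha : X -> X)
  (A : (X -> R) -> (X -> R)) (mu : (X -> R) -> R).
Hypotheses (cX : compact [set: X]) (ca : continuous alpha)
  (hA : transfer_operator alpha A).

Definition empirical_decay (c : R) : Prop :=
  exists (O : ((X -> R) -> R) -> Prop) (C : R) (chi : nat -> X -> R),
    [/\ weak_nbhs mu O,
        (forall n, (0 < n)%N ->
           contf (chi n) /\
           forall x, 0 <= chi n x /\ (Xn alpha n O x -> 1 <= chi n x)) &
        (forall n, (0 < n)%N -> forall x,
           `|iter n A (chi n) x| <= C * expR (n%:R * c))].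

Lemma noninvariant_bound (c : R) : ~ Defs.invariant alpha mu ->
  empirical_decay c.
Proof.
move=> hninv.
have [f [cf fne]] : exists f, contf f /\ mu (f \o alpha) <> mu f.
  apply: contrapT => h; apply: hninv => f cf; apply: contrapT => hf.
  by apply: h; exists f.
have cfa : contf (f \o alpha) by apply: contf_comp.
pose gap := `|mu (f \o alpha) - mu f|.
have gap0 : 0 < gap by rewrite normr_gt0 subr_eq0; apply/eqP.
have [M M0 fM] := contf_bounded _ _ _ cX cf.
(* For n > K one has 2 M / n < gap / 2, which will make X_n(O) empty. *)
pose K := Num.truncn (4 * M / gap).
have [Ac _ _ _ _] := hA.
have [B B0 hB] := contf_bounded _ _ _ cX (Ac _ (contf_cst _ _ 1)).
have AB x : A (fun=> 1) x <= B by apply: le_trans (ler_norm _) (hB x).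
pose O (nu : (X -> R) -> R) :=
  `|nu (f \o alpha) - mu (f \o alpha)| < gap / 4 /\ `|nu f - mu f| < gap / 4.
pose chi n (x : X) : R := if (n <= K)%N then 1 else 0.
(* Only the n <= K have a nonzero [chi n], and each is covered by its own term of this sum. *)
exists O, (\sum_(n < K.+1) B ^+ n / expR (n%:R * c)), chi; split.
- exists [:: f \o alpha; f], (gap / 4); split; first by rewrite divr_gt0.
    by move=> g [<-|[<-|[]]].
  by move=> nu _ h; split; apply: h; [left|right; left].
- move=> n n0; split; first by rewrite /chi; case: ifP => _; apply: contf_cst.
  move=> x; rewrite /chi; case: ifP => nK; first by rewrite ler01.
  split => // -[]; rewrite /empirical -!/(birkhoff _ _ _ _ _ _) => h1 h2.
  (* The two empirical averages differ by a telescoping sum over n, hence by at most 2 M / n, while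
     membership in [O] forces a difference above gap / 2. *)
  have tel : \sum_(i < n) (f \o alpha) (iter i alpha x) - \sum_(i < n) f (iter i alpha x) =
      f (iter n alpha x) - f x.
    rewrite -sumrB -(big_mkord xpredT (fun i => (f \o alpha) (iter i alpha x) - f (iter i alpha x))).
    by rewrite (telescope_sumr (fun i => f (iter i alpha x))).
  have nR : 0 < n%:R :> R by rewrite ltr0n.
  have small : `|n%:R^-1 * (f (iter n alpha x) - f x)| <= 2 * M / n%:R.
    have nV : 0 <= n%:R^-1 :> R by rewrite invr_ge0 ler0n.
    rewrite normrM ger0_norm // mulrC ler_wpM2r //.
    apply: le_trans (ler_normB _ _) _; have := fM x; have := fM (iter n alpha x); lra.
  have Kn : 4 * M / gap < n%:R.
    move/negbT: nK; rewrite -ltnNge => nK.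
    by apply: lt_le_trans (truncnS_gt _) _; rewrite ler_nat.
  have big : gap / 2 < 2 * M / n%:R.
    apply: lt_le_trans small; rewrite -tel mulrBr.
    move: h1 h2; rewrite /gap.
    set a := n%:R^-1 * _; set b := n%:R^-1 * _; set p := mu _; set q := mu _ => h1 h2.
    have : `|p - q| <= `|a - b| + `|a - p| + `|b - q|.
      rewrite (_ : p - q = (a - b) - (a - p) + (b - q)); last by ring.
      by apply: le_trans (ler_normD _ _) _; rewrite lerD2r; apply: ler_normB.
    move: gap0; rewrite /gap -/p -/q; lra.
  suff : 2 * M / n%:R < gap / 2 by rewrite ltNge ltW.
  by move: Kn; rewrite ltr_pdivrMr // ltr_pdivrMr //; lra.
- move=> n n0 x.
  have hn := transfer_iter _ _ _ _ n ca hA; have [_ _ _ A0 _] := hn.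
  have pos k : 0 <= B ^+ k / expR (k%:R * c).
    by rewrite divr_ge0 ?expR_ge0 // exprn_ge0.
  rewrite -ler_pdivrMr ?expR_gt0 //.
  rewrite /chi; case: ifP => nK.
    rewrite ger0_norm; last by apply: A0 => //; apply: contf_cst.
    rewrite (bigD1 (Ordinal (nK : (n < K.+1)%N))) //= -[leLHS]addr0 lerD //; last first.
      by apply: sumr_ge0.
    by rewrite ler_wpM2r ?invr_ge0 ?expR_ge0 //; apply: transfer_iter1 ca hA B0 AB n x.
  have -> : iter n A (fun=> 0) x = 0.
    rewrite -[RHS](mul0r (iter n A (fun=> 0) x)) -(transfer_evalZ _ _ _ _ _ hn).
      by congr (iter n A _ x); apply/funext => y; rewrite mul0r.
    exact: contf_cst.
  by rewrite normr0 mul0r sumr_ge0.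
Qed.

Lemma potential_bound (N : nat) (phi : X -> R) (c delta : R) : (0 < N)%N -> contf phi ->
  (forall x, iter N A (fun y => expR (phi y)) x <= 1) -> 0 < delta ->
  - mu phi + delta <= N%:R * c ->
  empirical_decay c.
Proof.
move=> N0 cphi hphi d0 hc.
have NR : 0 < N%:R :> R by rewrite ltr0n.
have [C hC] := transfer_birkhoff_bound _ _ _ _ _ _ cX ca hA N0 cphi hphi.
pose E n y := expR (N%:R^-1 * birkhoff _ _ alpha n phi y).
have cE n : contf (E n).
  apply: contf_expR; apply: contfM; first exact: contf_cst.
  exact: contf_birkhoff.
(* On X_n(O) the average of [phi] exceeds mu phi - delta, so n b + S_n phi / N >= 0 and chi n >= 1
   there; the hypothesis on [c] says b <= c. *)
pose b := N%:R^-1 * (delta - mu phi).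
pose chi n x := expR (n%:R * b) * E n x.
exists (fun nu => `|nu phi - mu phi| < delta), C, chi; split.
- exists [:: phi], delta; split => //; first by move=> f [<-|[]].
  by move=> nu _ h; apply: h; left.
- move=> n n0; split; first by apply: contfM => //; apply: contf_cst.
  move=> x; split; first by rewrite mulr_ge0 ?expR_ge0.
  rewrite /Xn /= /empirical -/(birkhoff _ _ alpha n phi x) => hx.
  have nR : 0 < n%:R :> R by rewrite ltr0n.
  rewrite /chi /E -expRD; apply: le_trans (expR_ge1Dx _); rewrite lerDl.
  have -> : n%:R * b + N%:R^-1 * birkhoff _ _ alpha n phi x =
      n%:R / N%:R * (delta + (n%:R^-1 * birkhoff _ _ alpha n phi x - mu phi)).
    by rewrite /b; field; rewrite !gt_eqF.
  rewrite mulr_ge0 ?divr_ge0 //.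
  by move: hx; rewrite ltr_norml => /andP[]; lra.
- move=> n n0 x.
  have hn := transfer_iter _ _ _ _ n ca hA; have [_ _ _ A0 _] := hn.
  rewrite ger0_norm; last first.
    apply: A0; first by apply: contfM => //; apply: contf_cst.
    by move=> y; rewrite mulr_ge0 ?expR_ge0.
  rewrite (transfer_evalZ _ _ _ _ _ hn) // mulrC.
  have C0 : 0 <= C.
    by apply: le_trans (hC n x); apply: (A0 (E n)) => // y; apply: expR_ge0.
  apply: ler_pM; [|exact: expR_ge0|exact: hC|].
    by apply: A0 => // y; apply: expR_ge0.
  rewrite ler_expR ler_wpM2l // /b ler_pdivrMl //; lra.
Qed.

End NeighbourhoodBounds.

Theorem theorem2p1 (R : realType) (X : topologicalType)
  (hcomp : compact [set: X]) (hhaus : hausdorff_space X)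
  (alpha : X -> X) (halpha : continuous alpha)
  (A : (X -> R) -> (X -> R)) (hA : transfer_operator alpha A)
  (mu : (X -> R) -> R) (hmu : prob_functional mu)
  (eps : R) (heps : 0 < eps) :
  exists (O : ((X -> R) -> R) -> Prop) (C : R) (chi : nat -> X -> R),
    [/\ weak_nbhs mu O,
        (forall n, (0 < n)%N ->
           contf (chi n) /\
           forall x, 0 <= chi n x /\ (Xn alpha n O x -> 1 <= chi n x)) &
        (forall n, (0 < n)%N -> forall x,
           `|iter n A (chi n) x| <= C * expR (n%:R * tau_exponent (t_entropy alpha A mu) eps))].
Proof.
have [hinv|hninv] := pselect (Defs.invariant alpha mu); last exact: noninvariant_bound.
have := t_entropy_lt_tau_exponent _ _ _ _ _ _ hcomp hA hmu heps.
move: (tau_exponent _ _) => c hc.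
have [N [D [s [N0 [_ Dg D1] hs sN]]]] := t_entropy_lt_witness _ _ _ _ _ _ hinv hc.
pose g (i : 'I_(size D)) := nth (fun=> 0) D i.
have cg i : contf (g i) by have [] := Dg _ (In_nth _ (fun=> 0) D i (ltn_ord i)).
have g0 i x : 0 <= g i x by have [_ ->] := Dg _ (In_nth _ (fun=> 0) D i (ltn_ord i)).
have g1 x : \sum_i g i x = 1 by rewrite -(D1 x) (big_nth (fun=> 0)) big_mkord.
have [_ _ mu0 _] := hmu.
(* The slack N c - s is halved: one half is the loss [eta] in the duality, the other the radius
   [delta] of the neighbourhood. *)
have gap0 : 0 < (N%:R * c - s) / 2 by rewrite divr_gt0 // subr_gt0.
have [|phi [cphi hphi muphi]] := potential_of_entropy_bound _ _ _ _ mu _ g s _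
  hcomp (transfer_iter _ _ _ _ N halpha hA) hmu cg g0 g1 _ gap0.
  move=> m hm mpos; apply: (tau_n_le_sum _ _ _ _ _ _ _ _ hs hm) => // i.
  exact: mu0 (cg i) (g0 i).
apply: (potential_bound _ _ _ _ _ hcomp halpha hA N phi c _ N0 cphi hphi gap0).
lra.
Qed.
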